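(* (i) Every tree-like grand-coalition-first action model is clear. (ii) There is a clear grand-coalition-first action model that is not tree-like.
   Context: $AG$ is a finite nonempty set of agents, $AP$ a countable set of atomic propositions. For a nonempty set $AC$ and $C\subseteq AG$, $JA_C$ is the set of functions $\sigma_C:C\to AC$; $\sigma_C\subseteq\sigma_{AG}$ means $\sigma_C$ is the restriction of $\sigma_{AG}$ to $C$. A grand-coalition-first action model is $(ST,AC,out_{AG},L)$ with $ST,AC$ nonempty, $out_{AG}:ST\times JA_{AG}\to\mathcal P(ST)$, $L:ST\to\mathcal P(AP)$. It determines $out_C(s,\sigma_C)=\bigcup\{out_{AG}(s,\sigma_{AG})\mid\sigma_C\subseteq\sigma_{AG}\}$ and $av_C(s)=\{\sigma_C\mid out_C(s,\sigma_C)\neq\emptyset\}$. It is clear if for all $s\in ST$ and $\sigma_{AG}\neq\sigma'_{AG}$ in $JA_{AG}$, $out_{AG}(s,\sigma_{AG})\cap out_{AG}(s,\sigma'_{AG})=\emptyset$. An $AG$-history from $s_0$ to $s_n$ is either $(s_0)$ (from $s_0$ to $s_0$) or $(s_0,\sigma^1,s_1,\dots,\sigma^n,s_n)$, $n\ge1$, with $\sigma^{i+1}\in av_{AG}(s_i)$ and $s_{i+1}\in out_{AG}(s_i,\sigma^{i+1})$. The model is tree-like if there is $r\in ST$ such that for every $s\in ST$ there is a unique $AG$-history from $r$ to $s$. *)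

(* Defs.v *)
From mathcomp Require Import all_boot.
From mathcomp Require Import boolp classical_sets.

Set Implicit Arguments.
Unset Strict Implicit.
Unset Printing Implicit Defensive.

(** [{set AG}] and [[set: AG]%SET] are finite sets of agents; [set T] is the
    classical powerset [T -> Prop] (notations in [%classic]). *)

(** Finite functions, so that two joint actions are equal as soon as they agree
    on every agent of the coalition. *)
Definition JA (AG : finType) (AC : Type) (C : {set AG}) : Type :=
  {ffun {a : AG | a \in C} -> AC}.

Definition full_agent (AG : finType) (a : AG) : {b : AG | b \in [set: AG]%SET} :=
  exist _ a (finset.in_setT a).

Definition sub_JA (AG : finType) (AC : Type) (C : {set AG})
    (sC : JA AC C) (sAG : JA AC [set: AG]%SET) : Prop :=
  forall a : {a : AG | a \in C}, sC a = sAG (full_agent (val a)).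

Record gcf_model (AG : finType) (AP : countType) : Type := GcfModel {
  ST : Type;
  AC : Type;
  ST_nonempty : inhabited ST;
  AC_nonempty : inhabited AC;
  out_AG : ST -> JA AC [set: AG]%SET -> set ST;
  label : ST -> set AP }.

Section Model.
Variables (AG : finType) (AP : countType) (M : gcf_model AG AP).

Definition out (C : {set AG}) (s : ST M) (sC : JA (AC M) C) : set (ST M) :=
  (\bigcup_(sAG in [set sAG | sub_JA sC sAG]) out_AG s sAG)%classic.

Definition av (C : {set AG}) (s : ST M) : set (JA (AC M) C) :=
  [set sC | out s sC <> set0]%classic.

Definition clear : Prop :=
  forall (s : ST M) (sAG sAG' : JA (AC M) [set: AG]%SET),
    sAG <> sAG' -> (out_AG s sAG `&` out_AG s sAG' = set0)%classic.

(** The sequence (s_0, sigma^1, s_1, ..., sigma^n, s_n) is encoded as the pair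
    (s_0, [:: (sigma^1, s_1); ...; (sigma^n, s_n)]). *)
Definition AG_sequence : Type :=
  (ST M * seq (JA (AC M) [set: AG]%SET * ST M))%type.

Fixpoint AG_steps (s : ST M) (p : seq (JA (AC M) [set: AG]%SET * ST M)) : Prop :=
  match p with
  | [::] => True
  | (sAG, t) :: p' => [/\ av s sAG, out_AG s sAG t & AG_steps t p']
  end.

Definition AG_history (s t : ST M) (h : AG_sequence) : Prop :=
  [/\ h.1 = s, last h.1 (unzip2 h.2) = t & AG_steps h.1 h.2].

Definition tree_like : Prop :=
  exists r : ST M, forall s : ST M, exists! h : AG_sequence, AG_history r s h.

(** The derived [out] at the grand coalition is the primitive [out_AG]. *)
Lemma out_grand (s : ST M) (sAG : JA (AC M) [set: AG]%SET) :
  out s sAG = out_AG s sAG.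
Proof.
have restr (sAG' : JA (AC M) [set: AG]%SET) : sub_JA sAG sAG' <-> sAG' = sAG.
  split=> [h|-> [a ha]]; last by congr (sAG _); apply: val_inj.
  by apply/ffunP=> -[a ha]; rewrite h; congr (sAG' _); apply: val_inj.
apply/seteqP; split=> [t [sAG' /restr -> //]|t st].
by exists sAG => //; apply/restr.
Qed.

End Model.

(* Main.v *)
Require Import Defs.
From mathcomp Require Import all_boot.
From mathcomp Require Import boolp classical_sets.

(** If two different joint actions could lead from [s] to [t], extending the
    history from the root to [s] by either of them would give two histories of
    [t].  Conversely, a single state with a single looping action is clear, but
    its histories can be prolonged at will. *)

(** By [out_grand], the successor [t] itself witnesses that the outcome set is nonempty. So a
    transition alone suffices to extend a history. *)
Lemma out_AG_av {AG : finType} {AP : countType} {M : gcf_model AG AP}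
    {s t : ST M} {sAG : JA (Defs.AC M) [set: AG]%SET} :
  out_AG s sAG t -> av s sAG.
Proof. by move=> st; rewrite /av /= out_grand => e; rewrite e in st. Qed.

Lemma AG_steps_rcons {AG : finType} {AP : countType} {M : gcf_model AG AP}
    {s t : ST M} {p} {sAG : JA (Defs.AC M) [set: AG]%SET} :
  AG_steps s p -> out_AG (last s (unzip2 p)) sAG t ->
  AG_steps s (rcons p (sAG, t)).
Proof.
elim: p s => [|[sAG' u] p IHp] s /=; first by move=> _ st; split=> //; exact: out_AG_av st.
by case=> avs su steps lt; split=> //; exact: IHp.
Qed.

Lemma AG_history_rcons {AG : finType} {AP : countType} {M : gcf_model AG AP}
    {r s t : ST M} {h} {sAG : JA (Defs.AC M) [set: AG]%SET} :
  AG_history r s h -> out_AG s sAG t ->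
  AG_history r t (h.1, rcons h.2 (sAG, t)).
Proof.
case=> hr hs steps st; split=> //=; first by rewrite /unzip2 map_rcons last_rcons.
by apply: AG_steps_rcons => //; rewrite hs.
Qed.

Lemma tree_like_clear (AG : finType) (AP : countType) (M : gcf_model AG AP) :
  tree_like M -> clear M.
Proof.
case=> r tree s sAG sAG' neq; apply/seteqP; split=> // t [st st'].
have [h [hs _]] := tree s; have [h' [_ uniq_h']] := tree t.
(* Both extensions of [h] equal [h']; comparing their last entries gives [sAG' = sAG], against
   [neq]. *)
have := uniq_h' _ (AG_history_rcons hs st).
rewrite (uniq_h' _ (AG_history_rcons hs st')) => -[] /rcons_inj [].
by move=> /esym.
Qed.

Definition loop_model (AG : finType) (AP : countType) : gcf_model AG AP :=
  @GcfModel AG AP unit unit (inhabits tt) (inhabits tt)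
    (fun _ _ => setT) (fun _ => set0).

(** Vacuous: functions into [unit] are all equal, so no two joint actions differ. *)
Lemma clear_loop_model (AG : finType) (AP : countType) :
  clear (loop_model AG AP).
Proof.
move=> s sAG sAG' []; apply/ffunP => a.
by case: (sAG a); case: (sAG' a).
Qed.

Lemma loop_model_not_tree_like (AG : finType) (AP : countType) :
  ~ tree_like (loop_model AG AP).
Proof.
case=> r /(_ r) [h [_ uniq_h]].
have hist0 : AG_history r r (r, [::]) by [].
have hist1 := @AG_history_rcons _ _ (loop_model AG AP) r r r _ [ffun=> tt] hist0 I.
(* Uniqueness would identify the empty sequence of steps with a one-step loop. *)
by have := uniq_h _ hist0; rewrite (uniq_h _ hist1).
Qed.

Theorem theorem6p4 (AG : finType) (AG_nonempty : 0 < #|AG|) (AP : countType) :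
  (forall M : gcf_model AG AP, tree_like M -> clear M) /\
  (exists M : gcf_model AG AP, clear M /\ ~ tree_like M).
Proof.
split; first exact: tree_like_clear.
exists (loop_model AG AP); split; first exact: clear_loop_model.
exact: loop_model_not_tree_like.
Qed.
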